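(* Let $X$ be a normed linear space, $M$ a linear subspace of $X$ and $f\in X\setminus M$. Assume $m^*\in P_M(f)$, i.e. $m^*\in M$ is a best approximant to $f$ from $M$. Set $$\gamma(f):=\inf\{\tau_+(f-m^*,m): m\in M,\ \|m\|=1\}.$$ Then $\gamma(f)\ge 0$ and, for all $m\in M$, $$\|f-m\|-\|f-m^*\|\ge \gamma(f)\,\|m-m^*\|.$$ Furthermore, if $\gamma>\gamma(f)$ then there exists an $\widetilde m\in M$ for which $$\|f-\widetilde m\|-\|f-m^*\|<\gamma\,\|\widetilde m-m^*\|.$$
   Context: $P_M(f)$ denotes the set of best approximants to $f$ from $M$: $m^*\in P_M(f)$ iff $m^*\in M$ and $\|f-m^*\|\le\|f-m\|$ for all $m\in M$. For $f,g\in X$, $\tau_+(f,g):=\lim_{t\to0^+}\frac{\|f+tg\|-\|f\|}{t}$ is the one-sided Gateaux derivative of the norm at $f$ in the direction $g$ (this limit always exists). *)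

(* Defs.v *)
From mathcomp Require Import all_boot all_order all_algebra.
From mathcomp Require Import all_classical all_reals all_analysis.

Set Implicit Arguments.
Unset Strict Implicit.
Unset Printing Implicit Defensive.

Import Order.TTheory GRing.Theory Num.Theory.
Import numFieldNormedType.Exports.

Local Open Scope classical_set_scope.
Local Open Scope ring_scope.

Definition best_approximants (R : realType) (X : normedModType R)
    (M : submodClosed X) (f : X) : set X :=
  [set m0 | m0 \in M /\ forall m, m \in M -> `|f - m0| <= `|f - m|].

Definition tau_plus (R : realType) (X : normedModType R) (f g : X) : R :=
  lim ((`|f + t *: g| - `|f|) / t @[t --> (0 : R)^'+]).

(* The infimum is taken in the extended reals: when M = {0} there is no
   m in M with `|m| = 1, and the infimum over the empty set is +oo (the real
   infimum [inf] would return 0 instead). *)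
Definition gamma (R : realType) (X : normedModType R)
    (M : submodClosed X) (f mstar : X) : \bar R :=
  ereal_inf [set (tau_plus (f - mstar) m)%:E |
              m in [set m : X | m \in M /\ `|m| = 1]].

(* Main.v *)
(** Along a ray, convexity of the norm makes the difference quotient
    [(`|h + t *: g| - `|h|) / t] nondecreasing in [t > 0], so [tau_plus h g] is
    its infimum.  With [h = f - mstar], each of the three claims is this fact
    read along the rays issued from [mstar] in the unit directions of [M]. *)

Require Import Defs.
From mathcomp Require Import all_boot all_order all_algebra.
From mathcomp Require Import lra.
From mathcomp Require Import all_classical all_reals all_analysis.

Set Implicit Arguments.
Unset Strict Implicit.
Unset Printing Implicit Defensive.

Import Order.TTheory GRing.Theory Num.Theory.
Import numFieldNormedType.Exports.

Local Open Scope classical_set_scope.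
Local Open Scope ring_scope.

Section DifferenceQuotient.
Context {R : realType} {X : normedModType R}.
Implicit Types (h g : X) (s t c : R).

(** The point [h + s *: g] is the convex combination of [h + t *: g] and [h] with weights [s / t]
    and [1 - s / t]; the proof works with this multiplied by [t]. *)
Lemma norm_quotient_nondecreasing h g s t : 0 < s -> s <= t ->
  (`|h + s *: g| - `|h|) / s <= (`|h + t *: g| - `|h|) / t.
Proof.
move=> s0 st; have t0 := lt_le_trans s0 st.
have : t * `|h + s *: g| <= s * `|h + t *: g| + (t - s) * `|h|.
  have -> : t * `|h + s *: g| = `|s *: (h + t *: g) + (t - s) *: h|.
    rewrite -[t in LHS](gtr0_norm t0) -normrZ; congr `| _ |.
    by rewrite scalerBl !scalerDr !scalerA (mulrC t) [RHS]addrC addrA subrK.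
  apply: le_trans (ler_normD _ _) _.
  by rewrite !normrZ (gtr0_norm s0) (ger0_norm (_ : 0 <= t - s)) // subr_ge0.
by rewrite ler_pdivrMr // mulrAC ler_pdivlMr //; nra.
Qed.

(** By the triangle inequality. The bound is uniform in [t], so together with monotonicity it makes
    the right limit at 0 exist. *)
Lemma norm_quotient_lb h g t : 0 < t ->
  - `|g| <= (`|h + t *: g| - `|h|) / t.
Proof.
move=> t0; rewrite ler_pdivlMr // lerBrDr.
have := ler_normB (h + t *: g) (t *: g).
by rewrite addrK normrZ (gtr0_norm t0); lra.
Qed.

Lemma norm_quotient_cvg h g :
  cvg ((`|h + t *: g| - `|h|) / t @[t --> (0 : R)^'+]).
Proof.
apply: nondecreasing_at_right_is_cvgr; near=> b.
  move=> s t; rewrite !in_itv /= => /andP[s0 _] _ st.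
  exact: norm_quotient_nondecreasing.
exists (- `|g|) => _ [t /= + <-]; rewrite in_itv /= => /andP[t0 _].
exact: norm_quotient_lb.
Unshelve. all: by end_near. Qed.

Lemma tau_plus_le h g t : 0 < t -> tau_plus h g <= (`|h + t *: g| - `|h|) / t.
Proof.
move=> t0; apply: limr_le; first exact: norm_quotient_cvg.
near=> s; apply: norm_quotient_nondecreasing; near: s.
  exact: nbhs_right_gt.
exact: nbhs_right_ltW.
Unshelve. all: by end_near. Qed.

Lemma le_tau_plus h g c :
  (forall t, 0 < t -> c <= (`|h + t *: g| - `|h|) / t) -> c <= tau_plus h g.
Proof.
move=> lec; apply: limr_ge; first exact: norm_quotient_cvg.
near=> s; apply: lec; near: s.
exact: nbhs_right_gt.
Unshelve. all: by end_near. Qed.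

(** Contrapositive of [le_tau_plus]; it supplies the step length of the near-optimal [mtilde]. *)
Lemma tau_plus_lt h g c : tau_plus h g < c ->
  exists2 t, 0 < t & (`|h + t *: g| - `|h|) / t < c.
Proof.
move=> tauc; apply: contrapT => noq; move: tauc; apply/negP; rewrite -leNgt.
apply: le_tau_plus => t t0; rewrite leNgt; apply/negP => qc.
by apply: noq; exists t.
Qed.

End DifferenceQuotient.

Theorem theorem1p4 (R : realType) (X : normedModType R) (M : submodClosed X)
    (f : X) (hf : f \notin M) (mstar : X)
    (hmstar : best_approximants M f mstar) :
  [/\ (0 <= gamma M f mstar)%E,
      forall m : X, m \in M ->
        (gamma M f mstar * `|m - mstar|%:E
           <= (`|f - m| - `|f - mstar|)%:E)%E
    & forall c : R, (gamma M f mstar < c%:E)%E ->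
        exists2 mtilde : X, mtilde \in M &
          `|f - mtilde| - `|f - mstar| < c * `|mtilde - mstar| ].
Proof.
have [mstarM mstarP] := hmstar.
have [_ MB] := GRing.submod_closedB (submodClosedP M).
(* Moving from [mstar] along [- m] moves the error [f - mstar] along [+ m]. *)
have rayE t m : f - (mstar - t *: m) = f - mstar + t *: m.
  by rewrite opprB addrA addrAC.
split.
- apply: le_ereal_inf_tmp => _ [m [mM _] <-]; rewrite lee_fin.
  apply: le_tau_plus => t t0; apply: divr_ge0; last exact: ltW.
  rewrite subr_ge0 -rayE; apply: mstarP.
  by rewrite MB // rpredZ.
(* At [m = mstar] there is no direction to normalise; [gamma] may be [+oo] there (when M = {0}), and
   the product with 0 is 0 by convention. *)
- move=> m mM; have [->|m_neq] := eqVneq m mstar.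
    by rewrite !subrr normr0 mule0.
  set t := `|m - mstar|.
  have t0 : 0 < t by rewrite normr_gt0 subr_eq0.
  (* With this sign [m = mstar - t *: u], so the increase of the error norm is [t] times the
     quotient at [t] in direction [u]. *)
  set u := t^-1 *: (mstar - m).
  have uM : u \in M by rewrite rpredZ // MB.
  have u1 : `|u| = 1.
    by rewrite normrZ distrC normfV (gtr0_norm t0) mulVf // gt_eqF.
  have fmE : f - m = f - mstar + t *: u.
    by rewrite scalerA divff ?gt_eqF// scale1r addrA subrK.
  rewrite fmE.
  apply: (@le_trans _ _ ((tau_plus (f - mstar) u)%:E * t%:E)%E).
    apply: lee_wpmul2r; first by rewrite lee_fin ltW.
    by apply: ereal_inf_lbound; exists u.
  by rewrite -EFinM lee_fin -ler_pdivlMr //; exact: tau_plus_le.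
- move=> c /ereal_inf_lt[_ [m [mM m1] <-]]; rewrite lte_fin.
  move=> /tau_plus_lt[t t0]; rewrite ltr_pdivrMr // => qc.
  (* Since [m] has norm 1, this point lies at distance exactly [t] from [mstar], and [qc] is the
     required bound. *)
  exists (mstar - t *: m); first by rewrite MB // rpredZ.
  by rewrite rayE [X in _ < c * `|X|]addrC addKr normrN normrZ m1 mulr1 (gtr0_norm t0).
Qed.
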